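(* Let $o\in X$ be a chosen root vertex. For $f \in L(X)$, the equation $\Delta^2 u = f$ has a solution $u\in L(X)$ if and only if $\int_X f\, d\pi = 0$. In this case, the unique solution with $u(o)=0$ is given by $$u = G_{X\setminus \{o\}}\Bigl(G_{X\setminus \{o\}}f - \int_X G_{X\setminus \{o\}}f\, d\pi\Bigr),$$ and all solutions are given by $u(\cdot) + c$, where $c \in \mathbb{C}$.
   Context: Let $(X,E)$ be a finite directed graph with $|X|\ge 2$, $E\subset X^2$ without loops, which is strongly connected. Each edge $(x,y)\in E$ carries a weight $a(x,y)>0$, and $a(x,y)=0$ if $(x,y)\notin E$. Put $m(x)=\sum_y a(x,y)$, $p(x,y)=a(x,y)/m(x)$, $P=(p(x,y))_{x,y\in X}$. $L(X)$ is the space of functions $X\to\mathbb{C}$ (column vectors), $Pu(x)=\sum_y p(x,y)u(y)$, and $\Delta=P-I$. $\pi$ denotes the unique stationary probability distribution of $P$ ($\pi P=\pi$, $\pi>0$, total mass $1$), and $\int_X f\,d\pi=\sum_{x\in X}f(x)\pi(x)$. For $A\subsetneq X$, $P_A=(p(x,y))_{x,y\in A}$ and $G_A=(I_A-P_A)^{-1}=\sum_{n\ge0}P_A^n$ (the inverse exists and the series converges); $G_A$ is viewed as a matrix over $X\times X$ with entries $0$ outside $A\times A$. A number appearing in place of a function denotes the corresponding constant function. *)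

(* Defs.v *)
From HB Require Import structures.
From mathcomp Require Import all_boot all_order all_algebra.
From mathcomp Require Import reals.
From mathcomp Require Import complex.

Set Implicit Arguments.
Unset Strict Implicit.
Unset Printing Implicit Defensive.

Import Order.TTheory GRing.Theory Num.Theory.
Local Open Scope ring_scope.

(* A matrix over X x X is a function [X -> X -> R]; L(X) is
   [{ffun X -> R[i]}], on which equality of functions is Leibniz equality. *)
Section WeightedDigraph.
Variables (R : realType) (X : finType).

Definition total_weight (a : X -> X -> R) (x : X) : R := \sum_y a x y.

Definition transition (a : X -> X -> R) (x y : X) : R :=
  a x y / total_weight a x.

Definition apply_kernel (K : X -> X -> R) (u : {ffun X -> R[i]}) :
    {ffun X -> R[i]} :=
  [ffun x => \sum_y (K x y)%:C%C * u y].

Definition laplacian (P : X -> X -> R) (u : {ffun X -> R[i]}) :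
    {ffun X -> R[i]} :=
  apply_kernel P u - u.

Definition stationary_distribution (P : X -> X -> R) (pi : X -> R) : Prop :=
  [/\ forall y, \sum_x pi x * P x y = pi y,
      forall x, 0 < pi x
    & \sum_x pi x = 1].

Definition integral (pi : X -> R) (f : {ffun X -> R[i]}) : R[i] :=
  \sum_x f x * (pi x)%:C%C.

Definition const_fun (c : R[i]) : {ffun X -> R[i]} := [ffun=> c].

(* P_A, with A enumerated by [enum_val : 'I_#|A| -> X]. *)
Definition restriction (P : X -> X -> R) (A : {set X}) : 'M[R]_#|A| :=
  \matrix_(i, j) P (enum_val i) (enum_val j).

(* Since [enum_val] is a bijection from ['I_#|A|] onto A, each of the two sums
   has exactly one term for an index in A and none for an index outside A. *)
Definition extend_by_zero (A : {set X}) (M : 'M[R]_#|A|) (x y : X) : R :=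
  \sum_(i | enum_val i == x) \sum_(j | enum_val j == y) M i j.

(* [invmx] is the inverse only on invertible matrices; I_A - P_A is one for the
   transition matrix of a strongly connected graph and a proper subset A. *)
Definition green (P : X -> X -> R) (A : {set X}) : X -> X -> R :=
  extend_by_zero (invmx (1%:M - restriction P A)).

End WeightedDigraph.

(* Main.v *)
Require Import Defs.
From HB Require Import structures.
From mathcomp Require Import all_boot all_order all_algebra.
From mathcomp Require Import reals.
From mathcomp Require Import complex.
From mathcomp Require Import ring.

Set Implicit Arguments.
Unset Strict Implicit.
Unset Printing Implicit Defensive.

Import Order.TTheory GRing.Theory Num.Theory.
Local Open Scope ring_scope.

(** A carré du champ computation replaces the maximum principle. Since the rows
    of [P] sum to 1, every complex function [u] satisfies pointwise
      sum_y P x y |u x - u y|^2 = Delta |u|^2 - u (Delta u)^* - u^* (Delta u),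
    and integrating against the stationary measure kills the first term. Hence a
    function with [u^* (Delta u) = 0] everywhere has zero energy, so it is equal
    at the two ends of every edge, and by strong connectivity it is constant
    ([energy_free_constant]).

    This one fact is used twice. With [Delta u = 0] it says that harmonic
    functions are constant, which gives uniqueness. With [u] vanishing off a
    proper subset [A] and harmonic on [A] it says [u = 0], so [I_A - P_A] is
    invertible and the Green kernel really inverts [- Delta] on [A]
    ([laplacian_green]).

    For the complement of a single vertex [o] the equation [Delta (G h) = - h]
    can fail only at [o]. Both sides have integral zero as soon as [h] does,
    and [pi o > 0], so it then holds at [o] as well ([poisson]). Adding a
    constant to [G f] does not change its Laplacian, and subtracting the mean
    makes it admissible in [poisson]; two applications solve
    [Delta^2 u = f], the two signs cancelling. *)

(** * Functions extended by zero from a subset *)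

Section ZeroExtension.
Variables (R : realType) (X : finType) (A : {set X}).

Lemma zero_extension_in (V : nmodType) (c : 'I_#|A| -> V) (k : 'I_#|A|) :
  \sum_(i | enum_val i == enum_val k) c i = c k.
Proof. by rewrite (big_pred1 k) // => i; rewrite /= (inj_eq enum_val_inj). Qed.

Lemma zero_extension_out (V : nmodType) (c : 'I_#|A| -> V) (x : X) :
  x \notin A -> \sum_(i | enum_val i == x) c i = 0.
Proof.
move=> xA; rewrite big_pred0 // => i; apply/negP => /eqP ix.
by rewrite -ix enum_valP in xA.
Qed.

Lemma sum_zero_extension (K : pzSemiRingType) (F : X -> K) (c : 'I_#|A| -> K) :
  \sum_y F y * (\sum_(i | enum_val i == y) c i) =
  \sum_i F (enum_val i) * c i.
Proof.
under eq_bigr do rewrite big_distrr /=.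
rewrite (exchange_big_dep xpredT) //=; apply: eq_bigr => i _.
by rewrite (big_pred1 (enum_val i)) // => y; rewrite /= eq_sym.
Qed.

Lemma apply_extend_by_zero (M : 'M[R]_#|A|) (f : {ffun X -> R[i]}) (x : X) :
  apply_kernel (extend_by_zero M) f x =
  \sum_(i | enum_val i == x) \sum_j (M i j)%:C%C * f (enum_val j).
Proof.
rewrite ffunE.
under eq_bigr => y _.
  rewrite /extend_by_zero rmorph_sum mulr_suml.
  under eq_bigr do rewrite rmorph_sum /= mulrC.
  over.
rewrite exchange_big /=; apply: eq_bigr => i _.
rewrite (sum_zero_extension f (fun j => (M i j)%:C%C)).
by apply: eq_bigr => j _; rewrite mulrC.
Qed.

End ZeroExtension.

(** * Integrals and Laplacians *)

Section Linearity.
Variables (R : realType) (X : finType).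
Implicit Types (u v : {ffun X -> R[i]}) (c : R[i]) (K : X -> X -> R).

Lemma ffun_subE u v x : (u - v) x = u x - v x.
Proof. by rewrite !ffunE. Qed.

Lemma laplacianE K u x : laplacian K u x = \sum_y (K x y)%:C%C * u y - u x.
Proof. by rewrite !ffunE. Qed.

Lemma laplacianB K u v : laplacian K (u - v) = laplacian K u - laplacian K v.
Proof.
apply/ffunP => x; rewrite [RHS]ffun_subE !laplacianE ffun_subE.
under eq_bigr do rewrite ffun_subE mulrBr.
rewrite sumrB; ring.
Qed.

Lemma integralB (pi : X -> R) u v :
  integral pi (u - v) = integral pi u - integral pi v.
Proof. by rewrite -sumrB; apply: eq_bigr => x _; rewrite ffun_subE mulrBl. Qed.

Lemma integralN (pi : X -> R) u : integral pi (- u) = - integral pi u.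
Proof. by rewrite -sumrN; apply: eq_bigr => x _; rewrite ffunE mulNr. Qed.

End Linearity.

(** * Irreducible Markov chains *)

Section IrreducibleChain.
Variables (R : realType) (X : finType) (E : rel X) (P : X -> X -> R).
Variable pi : X -> R.
Hypothesis P_ge0 : forall x y, 0 <= P x y.
Hypothesis P_stochastic : forall x, \sum_y P x y = 1.
Hypothesis P_edge : forall x y, E x y -> 0 < P x y.
Hypothesis E_connected : forall x y, connect E x y.
Hypothesis pi_stationary : stationary_distribution P pi.
Implicit Types (u h : {ffun X -> R[i]}) (c : R[i]).

Let pi_gt0 x : 0 < pi x. Proof. by case: pi_stationary. Qed.

Lemma integral_const c : integral pi (const_fun X c) = c.
Proof.
rewrite /integral; under eq_bigr do rewrite ffunE.
by rewrite -mulr_sumr -rmorph_sum; case: pi_stationary => _ _ ->; rewrite mulr1.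
Qed.

Lemma laplacian_const c : laplacian P (const_fun X c) = 0.
Proof.
apply/ffunP => x; rewrite laplacianE !ffunE.
under eq_bigr do rewrite ffunE.
by rewrite -mulr_suml -rmorph_sum P_stochastic mul1r subrr.
Qed.

(** Integrating [Delta u] moves [P] onto [pi], which it fixes. *)
Lemma integral_laplacian u : integral pi (laplacian P u) = 0.
Proof.
rewrite integralB; apply/eqP; rewrite subr_eq0; apply/eqP.
rewrite /integral; under eq_bigr do rewrite ffunE mulr_suml.
rewrite exchange_big /=; apply: eq_bigr => y _.
case: pi_stationary => pi_P _ _; rewrite -[in RHS]pi_P rmorph_sum mulr_sumr.
by apply: eq_bigr => x _; rewrite rmorphM /=; ring.
Qed.

Lemma edge_invariant_constant u :
  (forall x y, E x y -> u x = u y) -> forall x y, u x = u y.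
Proof.
move=> uE x y; have /connectP [p] := E_connected x y.
elim: p x => [|z p IHp] x /= => [_ -> //|/andP [/uE -> zp]]; exact: IHp.
Qed.

(** The left-hand side is the carré du champ of [u] up to a factor 2. *)
Lemma carre_du_champ u x :
  \sum_y (P x y)%:C%C * `|u x - u y| ^+ 2 =
  laplacian P [ffun y => `|u y| ^+ 2] x
  - u x * (laplacian P u x)^* - (u x)^* * laplacian P u x.
Proof.
have conjP y : ((P x y)%:C%C)^* = (P x y)%:C%C :> R[i] by exact: conjc_real.
have sumP : \sum_y (P x y)%:C%C = 1 :> R[i] by rewrite -rmorph_sum P_stochastic.
rewrite !laplacianE ffunE rmorphB rmorph_sum /=.
under [\sum_i ((P x i)%:C%C * u i)^*]eq_bigr do rewrite rmorphM /= conjP.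
under [\sum_y _ * [ffun=> _] _]eq_bigr do rewrite ffunE normCK.
transitivity (\sum_y ((P x y)%:C%C * (u x * (u x)^*)
    - u x * ((P x y)%:C%C * (u y)^*) - (u x)^* * ((P x y)%:C%C * u y)
    + (P x y)%:C%C * (u y * (u y)^*))).
  by apply: eq_bigr => y _; rewrite normCK rmorphB /=; ring.
rewrite big_split /= !sumrB -mulr_suml -!mulr_sumr sumP normCK; ring.
Qed.

(** The hypothesis covers both harmonic functions and functions that vanish
    wherever they fail to be harmonic. *)
Lemma energy_free_constant u :
  (forall x, (u x)^* * laplacian P u x = 0) -> forall x y, u x = u y.
Proof.
move=> u_free; apply: edge_invariant_constant => x y Exy.
have u_free' z : u z * (laplacian P u z)^* = 0.
  by rewrite -[u z in LHS]conjCK -rmorphM /= u_free rmorph0.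
have term_ge0 z w : 0 <= (P z w)%:C%C * `|u z - u w| ^+ 2 :> R[i].
  by rewrite mulr_ge0 ?exprn_ge0 // ler0c.
have energy0 :
    \sum_z (\sum_w (P z w)%:C%C * `|u z - u w| ^+ 2) * (pi z)%:C%C = 0 :> R[i].
  rewrite -[RHS](integral_laplacian [ffun y => `|u y| ^+ 2]).
  by apply: eq_bigr => z _; rewrite carre_du_champ u_free u_free' !subr0.
have /eqP := psumr_eq0P
  (fun z _ => mulr_ge0 (sumr_ge0 _ (fun w _ => term_ge0 z w))
                (etrans (ler0c _) (ltW (pi_gt0 z)))) energy0 (i := x) isT.
rewrite mulf_eq0 (fmorph_eq0 (real_complex R)) (gt_eqF (pi_gt0 x)) orbF.
move=> /eqP /(psumr_eq0P (fun w _ => term_ge0 x w)) /(_ y isT) /eqP.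
rewrite mulf_eq0 (fmorph_eq0 (real_complex R)) (gt_eqF (P_edge Exy)) /=.
by rewrite expf_eq0 /= normr_eq0 subr_eq0 => /eqP.
Qed.

Lemma harmonic_constant u :
  laplacian P u = 0 -> forall x, u = const_fun X (u x).
Proof.
move=> u_harm x; apply/ffunP => y; rewrite ffunE.
by apply: energy_free_constant => z; rewrite u_harm ffunE mulr0.
Qed.

(** * Green kernels *)

(** A kernel vector, extended by zero, is harmonic on [A] and zero off [A],
    so it is constant, and the constant is its value off [A]. *)
Lemma unitmx_restriction (A : {set X}) z :
  z \notin A -> 1%:M - restriction P A \in unitmx.
Proof.
move=> zA; rewrite -unitmx_tr -row_free_unit; apply: inj_row_free => v.
move=> /(congr1 trmx); rewrite trmx0 trmx_mul trmxK mulmxBl mul1mx => vker.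
pose u : {ffun X -> R[i]} := [ffun x => \sum_(i | enum_val i == x) (v 0 i)%:C%C].
have uA k : u (enum_val k) = (v 0 k)%:C%C by rewrite ffunE zero_extension_in.
have uNA x : x \notin A -> u x = 0.
  by move=> xA; rewrite ffunE zero_extension_out.
suff uconst x y : u x = u y.
  apply/rowP => k; apply: (fmorph_inj (real_complex R)).
  by rewrite /= -uA (uconst _ z) uNA // mxE.
apply: energy_free_constant x y => x.
have [xA|/uNA ->] := boolP (x \in A); last by rewrite rmorph0 mul0r.
rewrite -(enum_rankK_in xA xA); set k := enum_rank_in xA x.
suff -> : laplacian P u (enum_val k) = 0 by rewrite mulr0.
rewrite laplacianE uA; under eq_bigr do rewrite ffunE.
rewrite sum_zero_extension.
have /matrixP /(_ k 0) := vker; rewrite !mxE => /eqP.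
rewrite subr_eq0 => /eqP ->; rewrite rmorph_sum -sumrB big1 // => i _.
by rewrite !mxE rmorphM subrr.
Qed.

Lemma green_out (A : {set X}) h x :
  x \notin A -> apply_kernel (green P A) h x = 0.
Proof. by move=> xA; rewrite apply_extend_by_zero zero_extension_out. Qed.

Lemma laplacian_green (A : {set X}) h z x : z \notin A -> x \in A ->
  laplacian P (apply_kernel (green P A) h) x = - h x.
Proof.
move=> zA xA; rewrite -(enum_rankK_in xA xA); set k := enum_rank_in xA x.
rewrite laplacianE; under eq_bigr do rewrite apply_extend_by_zero.
rewrite sum_zero_extension apply_extend_by_zero zero_extension_in.
set M := invmx _.
have MP : M - restriction P A *m M = 1%:M.
  by rewrite -{1}[M]mul1mx -mulmxBl mulmxV // (unitmx_restriction zA).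
have Pinv j :
    \sum_i P (enum_val k) (enum_val i) * M i j = M k j - (k == j)%:R.
  have /matrixP /(_ k j) := MP; rewrite !mxE => <-.
  by rewrite opprB addrC subrK; apply: eq_bigr => i _; rewrite mxE.
transitivity (\sum_j (M k j - (k == j)%:R)%:C%C * h (enum_val j)
              - \sum_j (M k j)%:C%C * h (enum_val j)).
  congr (_ - _); under eq_bigr do rewrite mulr_sumr.
  rewrite exchange_big /=; apply: eq_bigr => j _.
  rewrite -Pinv rmorph_sum mulr_suml; apply: eq_bigr => i _.
  by rewrite rmorphM mulrA.
rewrite -sumrB (bigD1 k) //= big1 ?addr0 => [|j jk].
  by rewrite eqxx rmorphB rmorph1 /=; ring.
by rewrite eq_sym (negbTE jk) subr0 subrr.
Qed.

(** Off [o] the equation is the defining property of the Green kernel; at [o]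
    it follows since both sides have the same integral and [pi o > 0]. *)
Lemma poisson o h : integral pi h = 0 ->
  laplacian P (apply_kernel (green P (~: [set o])) h) = - h.
Proof.
move=> h0; set g := apply_kernel _ h.
have off x : x != o -> laplacian P g x = - h x.
  by move=> xo; apply: (@laplacian_green _ _ o); rewrite !inE ?eqxx.
have : integral pi (laplacian P g - (- h)) = 0.
  by rewrite integralB integral_laplacian integralN h0 oppr0 subr0.
rewrite /integral (bigD1 o) //= big1 ?addr0 => [/eqP|x xo]; last first.
  by rewrite ffun_subE off // ffunE subrr mul0r.
rewrite mulf_eq0 (fmorph_eq0 (real_complex R)) (gt_eqF (pi_gt0 o)) orbF.
rewrite ffun_subE subr_eq0 => /eqP go; apply/ffunP => x.
by have [-> //|/off ->] := eqVneq x o; rewrite ffunE.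
Qed.

(** [Delta (u - v)] is constant, and the constant is its integral, zero. *)
Lemma bilaplacian_unique u v :
  laplacian P (laplacian P u) = laplacian P (laplacian P v) ->
  forall x, u = v + const_fun X (u x - v x).
Proof.
move=> uv x; have luv : laplacian P (u - v) = 0.
  have := integral_laplacian (u - v).
  rewrite (@harmonic_constant (laplacian P (u - v)) _ x).
    by rewrite integral_const => ->; apply/ffunP => y; rewrite !ffunE.
  by rewrite 2!laplacianB uv subrr.
have := harmonic_constant luv x; rewrite !ffunE => <-.
by rewrite addrC subrK.
Qed.

End IrreducibleChain.

(** * Weighted digraphs *)

Section WeightedDigraph.
Variables (R : realType) (X : finType) (E : rel X) (a : X -> X -> R).
Hypothesis cardX : (2 <= #|X|)%N.
Hypothesis E_connected : forall x y : X, connect E x y.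
Hypothesis a_pos : forall x y : X, E x y -> 0 < a x y.
Hypothesis a_zero : forall x y : X, ~~ E x y -> a x y = 0.

(** The first edge of a path from [x] to some other vertex. It makes the
    division in [transition] a genuine normalization. *)
Lemma out_edge x : exists y, E x y.
Proof.
have /subsetPn [y _] : ~~ ([set: X] \subset [set x]).
  by apply: contraL cardX => /subset_leq_card; rewrite cardsT cards1 -ltnNge.
rewrite inE => yx.
have /connectP [[|z p] /=] := E_connected x y.
  by move=> _ yE; rewrite yE eqxx in yx.
by move=> /andP [xz _] _; exists z.
Qed.

Lemma weight_ge0 x y : 0 <= a x y.
Proof. by have [/a_pos /ltW|/a_zero ->] := boolP (E x y). Qed.

Lemma total_weight_gt0 x : 0 < total_weight a x.
Proof.
have [y /a_pos axy] := out_edge x.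
rewrite /total_weight (bigD1 y) //= ltr_pwDl ?sumr_ge0 // => z _.
exact: weight_ge0.
Qed.

Lemma transition_ge0 x y : 0 <= transition a x y.
Proof. by rewrite divr_ge0 ?weight_ge0 // ltW ?total_weight_gt0. Qed.

Lemma transition_edge x y : E x y -> 0 < transition a x y.
Proof. by move=> /a_pos axy; rewrite divr_gt0 ?total_weight_gt0. Qed.

Lemma transition_stochastic x : \sum_y transition a x y = 1.
Proof. by rewrite -mulr_suml divff ?gt_eqF ?total_weight_gt0. Qed.

End WeightedDigraph.

Theorem mainTheorem5 (R : realType) (X : finType) (E : rel X) (a : X -> X -> R)
    (cardX : (2 <= #|X|)%N)
    (loopless : irreflexive E)
    (strongly_connected : forall x y : X, connect E x y)
    (a_pos : forall x y : X, E x y -> 0 < a x y)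
    (a_zero : forall x y : X, ~~ E x y -> a x y = 0)
    (pi : X -> R)
    (pi_stationary : stationary_distribution (transition a) pi)
    (o : X) (f : {ffun X -> R[i]}) :
  let Delta := laplacian (transition a) in
  let G := apply_kernel (green (transition a) (~: [set o])) in
  let v := G (G f - const_fun X (integral pi (G f))) in
  ((exists u : {ffun X -> R[i]}, Delta (Delta u) = f) <-> integral pi f = 0) /\
  (integral pi f = 0 ->
     unique (fun u : {ffun X -> R[i]} => Delta (Delta u) = f /\ u o = 0) v /\
     (forall u : {ffun X -> R[i]},
        Delta (Delta u) = f <-> exists c : R[i], u = v + const_fun X c)).
Proof.
move=> Delta G v.
pose P_ge0 := transition_ge0 cardX strongly_connected a_pos a_zero.
pose P_stoch := transition_stochastic cardX strongly_connected a_pos a_zero.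
pose P_edge := transition_edge cardX strongly_connected a_pos a_zero.
have vf : integral pi f = 0 -> Delta (Delta v) = f.
  move=> f0; rewrite /v; set w := G f - _.
  have w0 : integral pi w = 0.
    by rewrite integralB (integral_const pi_stationary) subrr.
  rewrite /Delta /G (poisson P_ge0 P_stoch P_edge strongly_connected
    pi_stationary _ w0) opprB laplacianB (laplacian_const P_stoch) sub0r.
  by rewrite (poisson P_ge0 P_stoch P_edge strongly_connected
    pi_stationary _ f0) opprK.
have vo : v o = 0 by apply: green_out; rewrite !inE eqxx.
have uniq u := @bilaplacian_unique _ _ _ _ _ P_ge0 P_stoch P_edge
  strongly_connected pi_stationary u v.
split.
  split=> [[u <-]|/vf ?]; last by exists v.
  exact: integral_laplacian pi_stationary _.
move=> f0; split.
  split=> [|u [uf uo]]; first by split; first exact: vf.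
  have := uniq u (etrans uf (esym (vf f0))) o; rewrite uo vo subrr => ->.
  by apply/ffunP => x; rewrite !ffunE addr0.
move=> u; split=> [uf|[c ->]].
  by exists (u o - v o); exact: uniq (etrans uf (esym (vf f0))) o.
have -> : v + const_fun X c = v - const_fun X (- c).
  by apply/ffunP => x; rewrite !ffunE opprK.
by rewrite /Delta laplacianB (laplacian_const P_stoch) subr0; apply: vf.
Qed.
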